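(* Let $\alpha>0$ and let $\varphi\ge0$ be a measurable function on $\mathbb{C}$ satisfying condition $(I_1)$. Then $T_\varphi$ is bounded on $F^\infty_\alpha$ if and only if $\tilde{\varphi}_t\in L^\infty(\mathbb{C},dA)$ for every $t>0$.
   Context: $d\lambda_\alpha(w)=\frac{\alpha}{\pi}e^{-\alpha|w|^2}dA(w)$, $K_z(w)=e^{\alpha\bar z w}$. $\varphi$ satisfies condition $(I_1)$ if $\int_{\mathbb{C}}|\varphi(w)||K_z(w)|^2\,d\lambda_\alpha(w)<\infty$ for all $z\in\mathbb{C}$. $F^\infty_\alpha$ is the space of entire $f$ with $\|f\|_{\infty,\alpha}=\sup_z|f(z)|e^{-\alpha|z|^2/2}<\infty$. $T_\varphi f(z)=\int_{\mathbb{C}}\varphi(w)f(w)\overline{K_z(w)}\,d\lambda_\alpha(w)$. For $t>0$, $\tilde{\varphi}_t(z)=\frac{\alpha}{\pi}\int_{\mathbb{C}}\varphi(w)e^{-\alpha t|z-w|^2/2}\,dA(w)$. *)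

(* Defs.v *)
From HB Require Import structures.
From mathcomp Require Import all_boot all_order all_algebra.
From mathcomp Require Import all_classical all_reals all_analysis.
From mathcomp Require Import measurable_realfun.
From mathcomp Require Import complex.
Set Implicit Arguments. Unset Strict Implicit. Unset Printing Implicit Defensive.
Import Order.TTheory GRing.Theory Num.Theory.
Import numFieldNormedType.Exports.
Import ComplexField.
Local Open Scope classical_set_scope.
Local Open Scope ring_scope.
Local Open Scope complex_scope.

Section FockDefs.
Variable R : realType.

Definition toC (p : R * R) : R[i] := Complex p.1 p.2.

Definition dA := ((@lebesgue_measure R) \x (@lebesgue_measure R))%E.

Definition cnorm2 (z : R[i]) : R := (complex.Re z) ^+ 2 + (complex.Im z) ^+ 2.
Definition cabs (z : R[i]) : R := Num.sqrt (cnorm2 z).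

Definition cexp (u : R[i]) : R[i] :=
  Complex (expR (complex.Re u) * cos (complex.Im u)) (expR (complex.Re u) * sin (complex.Im u)).

Definition entire (f : R[i] -> R[i]) : Prop :=
  forall z : R[i], derivable (f : R[i]^o -> R[i]^o) z 1.

Definition gauss (alpha : R) (w : R[i]) : R :=
  alpha / pi * expR (- (alpha * cnorm2 w)).

Definition Kern (alpha : R) (z w : R[i]) : R[i] :=
  cexp (alpha%:C * (z^* * w)).

Definition cond_I1 (alpha : R) (phi : R[i] -> R) : Prop :=
  forall z : R[i],
    (\int[dA]_p (`|phi (toC p)| * cnorm2 (Kern alpha z (toC p))
                   * gauss alpha (toC p))%:E < +oo)%E.

Definition Finf_bound (alpha : R) (f : R[i] -> R[i]) (M : R) : Prop :=
  forall z : R[i], cabs (f z) * expR (- (alpha * cnorm2 z) / 2) <= M.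

Definition in_Finf (alpha : R) (f : R[i] -> R[i]) : Prop :=
  entire f /\ exists M : R, Finf_bound alpha f M.

(* integrand of T_phi f(z), as a function of w (density of d lambda_alpha
   included, so that the integral is taken w.r.t. dA) *)
Definition Toep_integrand (alpha : R) (phi : R[i] -> R) (f : R[i] -> R[i])
  (z w : R[i]) : R[i] :=
  (phi w * gauss alpha w)%:C * f w * (Kern alpha z w)^*.

Definition cintegral (g : R[i] -> R[i]) : R[i] :=
  Complex (Rintegral dA setT (fun p => complex.Re (g (toC p))))
          (Rintegral dA setT (fun p => complex.Im (g (toC p)))).

Definition Toep (alpha : R) (phi : R[i] -> R) (f : R[i] -> R[i]) (z : R[i])
  : R[i] := cintegral (Toep_integrand alpha phi f z).

(* T_phi is (well defined and) bounded on F^infty_alpha: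
   for every f in F^infty_alpha, the defining integral converges absolutely
   at every z, T_phi f is in F^infty_alpha, and
   ||T_phi f||_{infty,alpha} <= C ||f||_{infty,alpha}. *)
Definition Toep_bounded_Finf (alpha : R) (phi : R[i] -> R) : Prop :=
  exists C : R, forall f : R[i] -> R[i], in_Finf alpha f ->
    (forall z : R[i], dA.-integrable setT
        (fun p => (cabs (Toep_integrand alpha phi f z (toC p)))%:E))
    /\ entire (Toep alpha phi f)
    /\ (forall M : R, Finf_bound alpha f M ->
          Finf_bound alpha (Toep alpha phi f) (C * M)).

Definition tilde_phi (alpha : R) (phi : R[i] -> R) (t : R) (z : R[i]) : \bar R :=
  ((alpha / pi)%:E *
   \int[dA]_p (phi (toC p) * expR (- (alpha * t * cnorm2 (z - toC p)) / 2))%:E)%E.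

Definition in_Linf (g : R[i] -> \bar R) : Prop :=
  measurable_fun [set: R * R] ((fun p : R * R => g (toC p)) : R * R -> \bar R) /\
  exists M : R, {ae dA, forall p : R * R, (`|g (toC p)| <= M%:E)%E}.

End FockDefs.

(* Main.v *)
Require Import Defs.
From HB Require Import structures.
From mathcomp Require Import all_boot all_order all_algebra.
From mathcomp Require Import all_classical all_reals all_analysis.
From mathcomp Require Import measurable_realfun complex.
From mathcomp Require Import ring lra.
Import Order.TTheory GRing.Theory Num.Theory.
Import numFieldNormedType.Exports.
Import ComplexField.
Local Open Scope classical_set_scope.
Local Open Scope ring_scope.

(* Gaussians form a convolution semigroup, so an almost-everywhere bound on
   tilde phi_s gives, by Tonelli, a bound at every point on tilde phi_t for each
   t < s; for t > s the bound is inherited by monotonicity in t.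

   If T_phi is bounded, testing it on the reproducing kernel K_z at the point z
   gives T_phi K_z (z) = e^{alpha |z|^2} tilde phi_2(z), while the norm of K_z is
   at most e^{alpha |z|^2 / 2}; hence tilde phi_2 is bounded, and then every
   tilde phi_t is.

   Conversely |f(w)| <= M e^{alpha |w|^2 / 2} dominates the integrand of
   T_phi f(z) by M e^{alpha |z|^2 / 2} (alpha / pi) phi(w) e^{-alpha |z - w|^2 / 2},
   so the norm of T_phi f is at most 2 M sup tilde phi_1 (the 2 comes from
   estimating real and imaginary parts separately).  Differentiation under the
   integral sign follows from |e^u - 1 - u| <= 4 |u|^2 e^{|u|}: all the functions
   of w that occur are dominated by a multiple of phi(w) e^{-alpha |w|^2 / 4},
   which is integrable because tilde phi_{1/2}(0) is finite. *)

(** * Estimates for the complex exponential, and complex differentiability *)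

Section ComplexExp.
Variable R : realType.
Local Open Scope complex_scope.
Implicit Types (u v z w : R[i]) (x y : R).

Lemma normc_cabs z : `|z| = (cabs z)%:C.
Proof. by rewrite normc_def /cabs /cnorm2. Qed.

Lemma cabs_ge0 z : 0 <= cabs z. Proof. exact: sqrtr_ge0. Qed.

Lemma cabsM z w : cabs (z * w) = cabs z * cabs w.
Proof. by apply: complexI; rewrite rmorphM/= -!normc_cabs normrM. Qed.

Lemma cabs_eq0 z : (cabs z == 0) = (z == 0).
Proof.
by rewrite -(inj_eq (@complexI R)) -normc_cabs normr_eq0.
Qed.

Lemma cabs_real x : cabs x%:C = `|x|.
Proof. by rewrite /cabs /cnorm2/= expr0n/= addr0 sqrtr_sqr. Qed.

Lemma cabsJ z : cabs z^* = cabs z.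
Proof. by case: z => a b; rewrite /cabs /cnorm2/= sqrrN. Qed.

Lemma cabs2 z : cabs z ^+ 2 = cnorm2 z.
Proof. by rewrite sqr_sqrtr// addr_ge0 ?sqr_ge0. Qed.

Lemma normRe_le_cabs z : `|complex.Re z| <= cabs z.
Proof. by rewrite -sqrtr_sqr ler_wsqrtr// lerDl sqr_ge0. Qed.

Lemma normIm_le_cabs z : `|complex.Im z| <= cabs z.
Proof. by rewrite -sqrtr_sqr ler_wsqrtr// lerDr sqr_ge0. Qed.

Lemma cabs_le_ReIm z : cabs z <= `|complex.Re z| + `|complex.Im z|.
Proof.
rewrite -(ler_pXn2r (n := 2)) ?nnegrE ?cabs_ge0 ?addr_ge0//.
rewrite cabs2 /cnorm2 -[complex.Re z ^+ 2]real_normK ?num_real//.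
rewrite -[complex.Im z ^+ 2]real_normK ?num_real//.
have := normr_ge0 (complex.Re z); have := normr_ge0 (complex.Im z); nra.
Qed.

Lemma cexpD u v : cexp (u + v) = cexp u * cexp v.
Proof.
case: u v => [a b] [c d]; rewrite /cexp/= expRD cosD sinD; simpc.
by congr Complex; ring.
Qed.

Lemma cabs_cexp u : cabs (cexp u) = expR (complex.Re u).
Proof.
rewrite /cabs /cnorm2/= !exprMn -mulrDr cos2Dsin2 mulr1 sqrtr_sqr.
by rewrite ger0_norm ?expR_ge0.
Qed.

Lemma cexpJ u : (cexp u)^* = cexp u^*.
Proof. by case: u => a b; rewrite /cexp/= cosN sinN mulrN. Qed.

Lemma expR_sub1_le x : `|expR x - 1| <= `|x| * expR `|x|.
Proof.
have h1 := expR_ge1Dx x; have h2 := expR_ge1Dx (- x).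
have e : expR x * expR (- x) = 1 by rewrite -expRD subrr expR0.
have [x0|x0] := leP 0 x.
- rewrite !ger0_norm//; last by lra.
  have := expR_ge0 x; nra.
- rewrite (ltr0_norm x0) ler0_norm; last first.
    by rewrite subr_le0 -expR0 ler_expR ltW.
  have : 1 <= expR (- x) by rewrite -expR0 ler_expR; lra.
  nra.
Qed.

(** Everything comes from 1 + y <= e^y at y = x and y = -x. For x >= 0 it gives e^x - 1 <= x e^x,
    used twice; for x < 0, multiply by 1 - x >= 1 and use (1 + x)(1 - x) = 1 - x^2. *)
Lemma expR_taylor1_le x : `|expR x - 1 - x| <= x ^+ 2 * expR `|x|.
Proof.
have h1 := expR_ge1Dx x; have h2 := expR_ge1Dx (- x).
have e : expR x * expR (- x) = 1 by rewrite -expRD subrr expR0.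
rewrite ger0_norm; last by lra.
have h0 := expR_gt0 x; have h0' := expR_gt0 (- x).
have x2 := sqr_ge0 x.
have [x0|x0] := leP 0 x.
- rewrite ger0_norm//.
  have h3 : expR x * (1 - x) <= 1 by rewrite -[leRHS]e ler_wpM2l// ltW.
  have h4 : expR x - 1 <= x * expR x by lra.
  have : x * (expR x - 1) <= x * (x * expR x) by rewrite ler_wpM2l.
  lra.
- rewrite (ltr0_norm x0).
  have h3 : 1 <= expR (- x) by lra.
  have h4 : expR x * (1 - x) <= 1 by rewrite -[leRHS]e ler_wpM2l// ltW.
  have h5 : (expR x - 1 - x) * (1 - x) <= x ^+ 2 by lra.
  have h6 : 0 <= (expR x - 1 - x) * - x by rewrite mulr_ge0; lra.
  have : x ^+ 2 * 1 <= x ^+ 2 * expR (- x) by rewrite ler_wpM2l.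
  lra.
Qed.

(** Mean value theorem. Since [df] is bounded only for |y| <= |x|, [K] may depend on [x], so a
    linear bound on the derivative yields a quadratic bound on the function. *)
Lemma norm_sub0_le (f df : R -> R) (K x : R) :
  (forall y, is_derive y 1 f (df y)) -> (forall y, `|y| <= `|x| -> `|df y| <= K) ->
  `|f x - f 0| <= K * `|x|.
Proof.
move=> fdf dfK.
have cf (A : set R) : {within A, continuous f}.
  apply: continuous_subspaceT => y; apply: differentiable_continuous.
  by apply/derivable1_diffP; case: (fdf y).
have [x0|x0] := leP 0 x.
- have [c c0x ->] := MVT_segment x0 (fun y _ => fdf y) (cf _).
  rewrite subr0 normrM ler_wpM2r// dfK//.
  by move: c0x; rewrite in_itv/= => /andP[c0 cx]; rewrite !ger0_norm.
- have [c c0x] := MVT_segment (ltW x0) (fun y _ => fdf y) (cf _).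
  rewrite distrC => ->; rewrite sub0r normrM normrN ler_wpM2r// dfK//.
  move: c0x; rewrite in_itv/= => /andP[c0 cx].
  by rewrite (ltr0_norm x0) ler0_norm// lerN2.
Qed.

Lemma normr_sin_le x : `|sin x| <= `|x|.
Proof.
rewrite -[leRHS]mul1r -[sin x]subr0 -(sin0 R).
apply: (norm_sub0_le sin cos) => y _; exact: cos_max.
Qed.

Lemma cos_sub1_le x : `|cos x - 1| <= x ^+ 2.
Proof.
rewrite -cos0 -[x ^+ 2]real_normK ?num_real// expr2.
apply: (norm_sub0_le cos (fun y => - sin y)) => y xy.
by rewrite normrN (le_trans (normr_sin_le y)).
Qed.

Lemma sin_subx_le x : `|sin x - x| <= x ^+ 2.
Proof.
have -> : sin x - x = (fun y => sin y - y) x - (fun y => sin y - y) 0.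
  by rewrite /= sin0 !subr0.
rewrite -[x ^+ 2]real_normK ?num_real// expr2.
apply: (norm_sub0_le (fun y => sin y - y) (fun y => cos y - 1)) => y xy.
have -> : `|cos y - 1| = `|cos y - cos 0| by rewrite cos0.
rewrite (le_trans _ xy)// -[leRHS]mul1r.
apply: (norm_sub0_le cos (fun y => - sin y)) => t _.
by rewrite normrN sin_max.
Qed.

(** With u = a + ib, the parts are e^a (cos b - 1) + (e^a - 1 - a) and e^a (sin b - b) + b (e^a -
    1). Each of the four terms is at most |u|^2 e^{|u|}. *)
Lemma cexp_taylor1_le u : cabs (cexp u - 1 - u) <= 4 * cabs u ^+ 2 * expR (cabs u).
Proof.
have ha := normRe_le_cabs u; have hb := normIm_le_cabs u.
apply: le_trans (cabs_le_ReIm _) _.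
case: u ha hb => a b /= ha hb; set r := cabs _ in ha hb *.
have r0 : 0 <= r by exact: cabs_ge0.
have Er : 1 <= expR r by rewrite -expR0 ler_expR.
have Ea : expR `|a| <= expR r by rewrite ler_expR.
have a2 : a ^+ 2 <= r ^+ 2 by rewrite -real_normK ?num_real// ler_pXn2r.
have b2 : b ^+ 2 <= r ^+ 2 by rewrite -[b ^+ 2]real_normK ?num_real// ler_pXn2r.
have ea : expR a <= expR r by rewrite ler_expR (le_trans (ler_norm _)).
have r2 : 0 <= r ^+ 2 by exact: sqr_ge0.
have h1 : `|expR a * cos b - 1 - a| <= 2 * r ^+ 2 * expR r.
  rewrite (_ : _ - a = expR a * (cos b - 1) + (expR a - 1 - a)); last by ring.
  rewrite (le_trans (ler_normD _ _))// normrM (ger0_norm (expR_ge0 _)).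
  rewrite (_ : 2 * _ * _ = expR r * r ^+ 2 + r ^+ 2 * expR r); last by ring.
  rewrite lerD//.
    by rewrite ler_pM ?expR_ge0// (le_trans (cos_sub1_le _)).
  by rewrite (le_trans (expR_taylor1_le _))// ler_pM ?expR_ge0 ?sqr_ge0.
have h2 : `|expR a * sin b - b| <= 2 * r ^+ 2 * expR r.
  rewrite (_ : _ - b = expR a * (sin b - b) + b * (expR a - 1)); last by ring.
  rewrite (le_trans (ler_normD _ _))// !normrM (ger0_norm (expR_ge0 _)).
  rewrite (_ : 2 * _ * _ = expR r * r ^+ 2 + r * (r * expR r)); last by ring.
  rewrite lerD//.
    by rewrite ler_pM ?expR_ge0// (le_trans (sin_subx_le _)).
  rewrite ler_pM// (le_trans (expR_sub1_le _))// ler_pM ?expR_ge0//.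
rewrite subr0; lra.
Qed.

(** Dividing by h, the difference quotient is within K |h| of [D]. In this form an explicit Taylor
    remainder proves holomorphy. *)
Lemma derivable_of_quadratic_error (f : R[i] -> R[i]) z (D : R[i]) (K : R) :
  (forall h, cabs h <= 1 -> cabs (f (z + h) - f z - h * D) <= K * cabs h ^+ 2) ->
  derivable (f : R[i]^o -> R[i]^o) z 1.
Proof.
move=> H; apply/cvg_ex; exists D.
apply/cvgrPdist_le => /= e e0.
(* Here [e] is positive for the order of [R[i]], hence real. Using |K| + 1 makes the divisor
   positive whatever the sign of [K]. *)
have [d d0 Hd] : exists2 d : R, 0 < d & d%:C * (`|K| + 1)%:C <= e.
  have K1 : 0 < `|K| + 1 by rewrite ltr_wpDl.
  case: e e0 => e1 e2; rewrite ltcE/= => /andP[/eqP -> e0].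
  exists (e1 / (`|K| + 1)); first exact: divr_gt0.
  by rewrite -rmorphM/= divfK// gt_eqF.
have m0 : 0 < Num.min d 1 by rewrite lt_min d0 ltr01.
apply/nbhs_ballP; exists (Num.min d 1)%:C; first by rewrite /= ltcR.
move=> h /=; rewrite /ball/= sub0r normrN normc_cabs ltcR lt_min => /andP[hd h1] h0.
have ch : 0 < cabs h by rewrite lt_neqAle cabs_ge0 eq_sym cabs_eq0 h0.
rewrite distrC (_ : _ - D = h^-1 * (f (z + h) - f z - h * D)); last first.
  by rewrite mulrBr mulKf// -[h%:A]/(h * 1) mulr1 [h + z]addrC.
refine (le_trans _ Hd).
rewrite normc_cabs -rmorphM/= lecR -(ler_pM2l ch) -cabsM mulVKf//.
apply: le_trans (H h (ltW h1)) _.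
rewrite expr2 mulrA (mulrC (cabs h)) ler_pM2r// mulrC.
apply: (@le_trans _ _ (cabs h * (`|K| + 1))).
  by rewrite ler_wpM2l ?cabs_ge0// ler_wpDr// ler_norm.
by rewrite ler_wpM2r ?addr_ge0// ltW.
Qed.

Lemma entire_continuous (f : R[i] -> R[i]) z (e : R) : entire f -> 0 < e ->
  exists2 d : R, 0 < d & forall w, cabs (w - z) < d -> cabs (f w - f z) < e.
Proof.
move=> ef e0.
have : {for z, continuous (f : R[i]^o -> R[i]^o)}.
  apply: differentiable_continuous; apply/derivable1_diffP; exact: ef.
move=> /cvgrPdist_lt /(_ e%:C); rewrite ltcR => /(_ e0) /nbhs_ballP[d /= d0 Hd].
move: d0 Hd; case: d => d d'; rewrite ltcE/= => /andP[/eqP -> d0] Hd.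
exists d => // w wz; rewrite -ltcR -normc_cabs distrC; apply: Hd.
by rewrite /ball/= distrC normc_cabs ltcR.
Qed.

End ComplexExp.

(** * Sigma-finiteness of planar Lebesgue measure *)

Lemma sigma_finite_dA (R : realType) : sigma_finite setT (@dA R).
Proof.
exists (fun n : nat => `[- n%:R, n%:R] `*` `[- n%:R, n%:R]).
  apply/seteqP; split => // -[x y] _.
  have n0 : 0 <= `|x| + `|y| by rewrite addr_ge0.
  exists (Num.bound (`|x| + `|y|)) => //; have := archi_boundP n0.
  have := normr_ge0 x; have := normr_ge0 y => y0 x0 lt_n.
  by split; rewrite /= in_itv/= -ler_norml; lra.
move=> n; split; first exact: measurableX.
rewrite /dA product_measure1E//= lebesgue_measure_itv/=.
by case: ifP => _; rewrite ?mule0// -EFinD -EFinM ltry.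
Qed.

(* The sigma-finite instance inferred for [\x] only covers products of
   subprobabilities, hence a separate one for planar Lebesgue measure. *)
HB.instance Definition _ (R : realType) := Measure.on (@dA R).
HB.instance Definition _ (R : realType) :=
  Measure_isSigmaFinite.Build _ _ _ (@dA R) (sigma_finite_dA R).

(** * Gaussian integrals and the heat semigroup on the plane *)

Section Gaussian.
Variable R : realType.
Local Notation mu := (@lebesgue_measure R).
Local Notation mu2 := (@dA R).

(** The integrand is a multiple of the normal density of mean [m] and variance 1/(2s). What matters
    later is that the value is positive and independent of the centre. *)
Lemma integral_gauss1 (s : R) : 0 < s -> exists2 C : R, 0 < C &
  forall m : R, (\int[mu]_x (expR (- (s * (x - m) ^+ 2)))%:E = C%:E)%E.
Proof.
move=> s0; pose sg := Num.sqrt ((2 * s)^-1).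
have s20 : 0 < (2 * s)^-1 by rewrite invr_gt0 mulr_gt0.
have sg0 : sg != 0 by rewrite gt_eqF// sqrtr_gt0.
have sg2 : sg ^+ 2 *+ 2 = s^-1.
  rewrite sqr_sqrtr ?ltW// -mulr_natr; field; exact: lt0r_neq0.
have pk := normal_peak_gt0 sg0.
exists (normal_peak sg)^-1; first by rewrite invr_gt0.
move=> m.
transitivity (\int[mu]_x ((normal_peak sg)^-1%:E * (normal_pdf m sg x)%:E))%E.
  apply: eq_integral => x _; rewrite normal_pdfE//= -EFinM mulKf ?gt_eqF//.
  by rewrite /normal_fun sg2 invrK mulNr mulrC.
rewrite ge0_integralZl//.
- by rewrite integral_normal_pdf mule1.
- by apply/measurable_EFinP; exact: measurable_normal_pdf.
- by move=> x _; rewrite lee_fin normal_pdf_ge0.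
- by rewrite lee_fin invr_ge0 ltW.
Qed.

(** The heat kernel at time 1/(4a), without its normalising factor: a larger [a] means less
    smoothing. *)
Definition hker (a : R) (p q : R * R) : R :=
  expR (- (a * ((p.1 - q.1) ^+ 2 + (p.2 - q.2) ^+ 2))).

Lemma hkerC a p q : hker a p q = hker a q p.
Proof. by rewrite /hker; congr expR; ring. Qed.

Lemma hker_ge0 a p q : 0 <= hker a p q. Proof. exact: expR_ge0. Qed.

Lemma measurable_hker (a : R) :
  measurable_fun [set: (R * R) * (R * R)] (fun pq => hker a pq.1 pq.2).
Proof.
rewrite /hker; apply: measurableT_comp => //; apply: measurableT_comp => //.
apply: measurable_funM => //; apply: measurable_funD; apply: measurable_funX;
apply: measurable_funB; by do 2 apply: measurableT_comp => //.
Qed.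

Lemma measurable_hkerl (a : R) q :
  measurable_fun [set: R * R] (fun p => hker a p q).
Proof.
by apply: (measurableT_comp (measurable_hker a) (f := fun pq => hker a pq.1 pq.2)
  (g := fun p => (p, q))).
Qed.

Lemma integral_hker (a : R) : 0 < a -> exists2 C : R, 0 < C &
  forall q : R * R, (\int[mu2]_p (hker a p q)%:E = C%:E)%E.
Proof.
move=> a0; have [C C0 HC] := integral_gauss1 a a0.
exists (C * C); first exact: mulr_gt0.
move=> q; rewrite (fubini_tonelli1 (m1 := mu) (m2 := mu) (fun p => (hker a p q)%:E)).
- rewrite /fubini_F/=.
  transitivity (\int[mu]_x (C%:E * (expR (- (a * (x - q.1) ^+ 2)))%:E))%E.
    apply: eq_integral => x _.
    transitivity (\int[mu]_y ((expR (- (a * (x - q.1) ^+ 2)))%:E *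
      (expR (- (a * (y - q.2) ^+ 2)))%:E))%E.
      by apply: eq_integral => y _; rewrite /hker/= -EFinM -expRD; congr (expR _)%:E; ring.
    rewrite ge0_integralZl//.
    + by rewrite HC muleC.
    + apply/measurable_EFinP; apply: measurableT_comp => //; apply: measurableT_comp => //.
      by apply: measurable_funM => //; apply: measurable_funX; apply: measurable_funB.
  rewrite ge0_integralZl//.
  + by rewrite HC.
  + apply/measurable_EFinP; apply: measurableT_comp => //; apply: measurableT_comp => //.
    by apply: measurable_funM => //; apply: measurable_funX; apply: measurable_funB.
  + by rewrite lee_fin ltW.
- by apply/measurable_EFinP; exact: measurable_hkerl.
- by move=> p; rewrite lee_fin hker_ge0.
Qed.

(** Completing the square in [p]. Integrating over [p] then gives the semigroup law, in which the
    inverses of the parameters add. *)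
Lemma hkerM (a b : R) (p q z : R * R) : 0 < a -> 0 < b ->
  hker a p q * hker b p z =
  hker (a + b) p ((a * q.1 + b * z.1) / (a + b), (a * q.2 + b * z.2) / (a + b)) *
  hker (a * b / (a + b)) z q.
Proof.
move=> a0 b0; rewrite /hker -!expRD; congr expR => /=; field.
by rewrite gt_eqF// addr_gt0.
Qed.

Variable psi : R * R -> R.
Hypothesis mpsi : measurable_fun setT psi.
Hypothesis psi0 : forall p, 0 <= psi p.

(** Valued in the extended reals because finiteness is itself to be established. *)
Definition heat (a : R) (p : R * R) : \bar R :=
  (\int[mu2]_q (psi q * hker a p q)%:E)%E.

Lemma measurable_psi_hker a z : measurable_fun setT (fun q => (psi q * hker a z q)%:E).
Proof.
apply/measurable_EFinP; apply: measurable_funM => //.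
rewrite (_ : hker a z = fun q => hker a q z); first exact: measurable_hkerl.
by apply/funext => q; rewrite hkerC.
Qed.

Lemma measurable_heat a : measurable_fun setT (heat a).
Proof.
pose f (pq : (R * R) * (R * R)) := (psi pq.2 * hker a pq.1 pq.2)%:E.
have mf : measurable_fun setT f.
  apply/measurable_EFinP; apply: measurable_funM; last exact: measurable_hker.
  exact: measurableT_comp.
have f0 pq : (0 <= f pq)%E by rewrite lee_fin mulr_ge0 ?hker_ge0.
exact: (measurable_fun_fubini_tonelli_F (m2 := mu2) f mf f0).
Qed.

Lemma heat_ge0 a z : (0 <= heat a z)%E.
Proof. by apply: integral_ge0 => p _; rewrite lee_fin mulr_ge0 ?hker_ge0. Qed.

Lemma heat_anti a c z : 0 <= c -> c <= a -> (heat a z <= heat c z)%E.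
Proof.
move=> c0 ca; apply: ge0_le_integral => //.
- by move=> p _; rewrite lee_fin mulr_ge0 ?hker_ge0.
- exact: measurable_psi_hker.
- exact: measurable_psi_hker.
- move=> p _; rewrite lee_fin ler_wpM2l// ler_expR lerN2 ler_wpM2r//.
  by rewrite addr_ge0 ?sqr_ge0.
Qed.

(* Averaging [heat a] against the Gaussian of parameter [b] gives a multiple of
   [heat (a * b / (a + b))], and [b] is chosen so that this parameter is [c].
   The average does not see null sets, so the resulting bound holds everywhere. *)
Lemma heat_bound (a c M : R) : 0 < c -> c < a ->
  {ae mu2, forall p, (heat a p <= M%:E)%E} ->
  exists C : R, forall z, (heat c z <= C%:E)%E.
Proof.
move=> c0 ca HM.
have a0 : 0 < a by lra.
pose b := a * c / (a - c).
have ac0 : 0 < a - c by lra.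
have b0 : 0 < b by rewrite divr_gt0// mulr_gt0.
have abc : a * b / (a + b) = c.
  rewrite /b; field; apply/andP; split; first by rewrite gt_eqF.
  by rewrite (_ : _ + _ = a * a) ?gt_eqF ?mulr_gt0//; ring.
have [N N0 HN] := integral_hker (a + b) (addr_gt0 a0 b0).
have [L L0 HL] := integral_hker b b0.
(* [N] and [L] are the total masses of the Gaussians of parameters a + b and b. [M] comes without a
   sign, and the maximum keeps the dominating function nonnegative. *)
exists (N^-1 * (Num.max M 0 * L)) => z.
(* Tonelli moves the integral over [p] inside, where [hkerM] leaves a Gaussian of mass [N] whatever
   its centre. *)
have e1 : (\int[mu2]_p (heat a p * (hker b p z)%:E) = N%:E * heat c z)%E.
  transitivity (\int[mu2]_p \int[mu2]_q (psi q * hker a p q * hker b p z)%:E)%E.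
    apply: eq_integral => p _; rewrite /heat -ge0_integralZr//.
    - exact: measurable_psi_hker.
    - by move=> q _; rewrite lee_fin mulr_ge0 ?hker_ge0.
    - by rewrite lee_fin hker_ge0.
  rewrite (fubini_tonelli (m1 := mu2) (m2 := mu2)
    (fun pq : (R * R) * (R * R) => (psi pq.2 * hker a pq.1 pq.2 * hker b pq.1 z)%:E))/=; first last.
  - by move=> pq; rewrite lee_fin !mulr_ge0 ?hker_ge0.
  - apply/measurable_EFinP; apply: measurable_funM; first apply: measurable_funM.
    + exact: measurableT_comp.
    + exact: measurable_hker.
    + exact: (measurableT_comp (measurable_hkerl b z) measurable_fst).
  rewrite /heat -ge0_integralZl//; first last.
  - by rewrite lee_fin ltW.
  - by move=> q _; rewrite lee_fin mulr_ge0 ?hker_ge0.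
  - exact: measurable_psi_hker.
  apply: eq_integral => q _.
  transitivity (\int[mu2]_p ((psi q * hker c z q)%:E *
    (hker (a + b) p ((a * q.1 + b * z.1) / (a + b), (a * q.2 + b * z.2) / (a + b)))%:E))%E.
    apply: eq_integral => p _; rewrite -EFinM -mulrA hkerM// abc; congr EFin; ring.
  rewrite ge0_integralZl//.
  - by rewrite HN muleC.
  - by apply/measurable_EFinP; exact: measurable_hkerl.
  - by move=> p _; rewrite lee_fin hker_ge0.
  - by rewrite lee_fin mulr_ge0 ?hker_ge0.
have e2 : (N%:E * heat c z <= (Num.max M 0 * L)%:E)%E.
  rewrite -e1 EFinM -(HL z) -ge0_integralZl//; first last.
  - by rewrite lee_fin le_max lexx orbT.
  - by move=> p _; rewrite lee_fin hker_ge0.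
  - by apply/measurable_EFinP; exact: measurable_hkerl.
  apply: ae_ge0_le_integral => //.
  - by move=> p _; rewrite mule_ge0// ?heat_ge0// lee_fin hker_ge0.
  - apply: emeasurable_funM; first exact: measurable_heat.
    by apply/measurable_EFinP; exact: measurable_hkerl.
  - by move=> p _; rewrite -EFinM lee_fin mulr_ge0 ?hker_ge0// le_max lexx orbT.
  - apply/measurable_EFinP; apply: measurable_funM => //; exact: measurable_hkerl.
  - apply: filterS HM; first exact: (ae_filter_ringOfSetsType mu2).
    move=> p Hp _; rewrite lee_pmul2r ?lte_fin ?expR_gt0//.
    by rewrite (le_trans Hp)// lee_fin le_max lexx.
rewrite -[heat c z]mul1e -(mulVf (lt0r_neq0 N0)) EFinM -muleA EFinM.
by rewrite lee_wpmul2l// lee_fin invr_ge0 ltW.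
Qed.

End Gaussian.

(** * Measurability and integration of complex functions on the plane *)

Section PlaneMeasurability.
Variable R : realType.
Local Open Scope complex_scope.

(** The preimage of an open ray is open, hence the union of the countably many open squares with
    rational centre and radius that it contains; each square is a measurable rectangle. *)
Lemma measurable_continuous_plane (f : R * R -> R) :
  (forall p (e : R), 0 < e -> exists2 d : R, 0 < d & forall q : R * R,
    `|q.1 - p.1| < d -> `|q.2 - p.2| < d -> `|f q - f p| < e) ->
  measurable_fun setT f.
Proof.
move=> cf; apply: (measurability _ (RGenOInfty.measurableE R)).
move=> _ [_ [x ->] <-]; rewrite setTI; set U := _ @^-1` _.
pose B (k : rat * rat * rat) : set (R * R) :=
  `]ratr k.1.1 - ratr k.2, ratr k.1.1 + ratr k.2[ `*`
  `]ratr k.1.2 - ratr k.2, ratr k.1.2 + ratr k.2[.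
pose F k := if `[< B k `<=` U >] then B k else set0.
rewrite (_ : U = \bigcup_k F k).
  apply: countable_bigcupT_measurable; first exact: countableP.
  by move=> k; rewrite /F; case: ifPn => // _; exact: measurableX.
apply/seteqP; split; last first.
  by move=> p [k _]; rewrite /F; case: ifPn => // /asboolP; exact.
move=> p Up; have xp : 0 < f p - x by move: Up; rewrite /U/= in_itv/= andbT subr_gt0.
have [d d0 Hd] := cf p _ xp.
(* The rational centre lies within r < d/2 of [p], so every point of the square is within 2r < d of
   [p]. *)
have d20 : 0 < d / 2 by rewrite divr_gt0.
have [r] := rat_in_itvoo d20; rewrite in_itv/= => /andP[r0 rd].
have h (y : R) : y - ratr r < y + ratr r by lra.
have [q1] := rat_in_itvoo (h p.1); rewrite in_itv/= => /andP[q1l q1r].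
have [q2] := rat_in_itvoo (h p.2); rewrite in_itv/= => /andP[q2l q2r].
exists (q1, q2, r) => //; rewrite /F asboolT.
  by rewrite /B/= !in_itv/=; split; apply/andP; split; lra.
move=> q; rewrite /B/= !in_itv/= => -[/andP[a1 a2] /andP[a3 a4]].
rewrite /U/= in_itv/= andbT.
suff : `|f q - f p| < f p - x by rewrite ltr_norml => /andP[]; lra.
by apply: Hd; rewrite ltr_norml; apply/andP; split; lra.
Qed.

(** Stated by parts and on pairs of reals, to match the form of [cintegral]. *)
Definition cmeas (g : R[i] -> R[i]) :=
  measurable_fun [set: R * R] (fun p : R * R => complex.Re (g (toC p))) /\
  measurable_fun [set: R * R] (fun p : R * R => complex.Im (g (toC p))).

Lemma cmeas_entire f : entire f -> cmeas f.
Proof.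
move=> ef.
have H p (e : R) : 0 < e -> exists2 d : R, 0 < d & forall q : R * R,
    `|q.1 - p.1| < d -> `|q.2 - p.2| < d -> cabs (f (toC q) - f (toC p)) < e.
  move=> e0; have [d d0 Hd] := entire_continuous R f (toC p) e ef e0.
  exists (d / 2); first by rewrite divr_gt0.
  move=> q h1 h2; apply: Hd; apply: le_lt_trans (cabs_le_ReIm _ _) _.
  by rewrite /=; lra.
split; apply: measurable_continuous_plane => p e e0; have [d d0 Hd] := H p e e0;
  exists d => // q h1 h2; apply: le_lt_trans (Hd q h1 h2); rewrite -raddfB/=.
- exact: normRe_le_cabs.
- exact: normIm_le_cabs.
Qed.

Lemma cmeasM f g : cmeas f -> cmeas g -> cmeas (fun z => f z * g z).
Proof.
move=> [f1 f2] [g1 g2]; split.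
- rewrite (_ : (fun p => _) = fun p : R * R => complex.Re (f (toC p)) * complex.Re (g (toC p)) -
    complex.Im (f (toC p)) * complex.Im (g (toC p))).
    by apply: measurable_funB; apply: measurable_funM.
  by apply/funext => p; case: (f _) => a b; case: (g _).
- rewrite (_ : (fun p => _) = fun p : R * R => complex.Re (f (toC p)) * complex.Im (g (toC p)) +
    complex.Im (f (toC p)) * complex.Re (g (toC p))).
    by apply: measurable_funD; apply: measurable_funM.
  by apply/funext => p; case: (f _) => a b; case: (g _).
Qed.

Lemma cmeas_conj f : cmeas f -> cmeas (fun z => (f z)^*).
Proof.
move=> [f1 f2]; split.
- rewrite (_ : (fun p => _) = fun p : R * R => complex.Re (f (toC p)))//.
  by apply/funext => p; case: (f _).
- rewrite (_ : (fun p => _) = fun p : R * R => - complex.Im (f (toC p))).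
    exact: measurableT_comp.
  by apply/funext => p; case: (f _).
Qed.

Lemma cmeas_real (phi : R[i] -> R) :
  measurable_fun [set: R * R] (fun p : R * R => phi (toC p)) ->
  cmeas (fun z => (phi z)%:C).
Proof. by move=> mphi; split => //=; exact: measurable_cst. Qed.

Lemma measurable_cabs g : cmeas g ->
  measurable_fun [set: R * R] (fun p : R * R => cabs (g (toC p))).
Proof.
move=> [g1 g2].
have ms : measurable_fun [set: R] (@Num.sqrt R).
  by apply: continuous_measurable_fun; exact: sqrt_continuous.
rewrite (_ : (fun p => _) = Num.sqrt \o (fun p : R * R =>
  complex.Re (g (toC p)) ^+ 2 + complex.Im (g (toC p)) ^+ 2))//.
apply: (measurableT_comp ms).
by apply: measurable_funD; apply: measurable_funX.
Qed.

Definition cintegrable (g : R[i] -> R[i]) :=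
  (@dA R).-integrable setT (fun p : R * R => (complex.Re (g (toC p)))%:E) /\
  (@dA R).-integrable setT (fun p : R * R => (complex.Im (g (toC p)))%:E).

Lemma cintegrable_dom g (H : R * R -> R) : cmeas g ->
  (@dA R).-integrable setT (EFin \o H) ->
  (forall p, cabs (g (toC p)) <= H p) -> cintegrable g.
Proof.
move=> [g1 g2] iH gH; split; apply: le_integrable iH => //.
- exact/measurable_EFinP.
- move=> p _; rewrite /= lee_fin.
  by rewrite (le_trans (normRe_le_cabs _ _))// (le_trans (gH p))// ler_norm.
- exact/measurable_EFinP.
- move=> p _; rewrite /= lee_fin.
  by rewrite (le_trans (normIm_le_cabs _ _))// (le_trans (gH p))// ler_norm.
Qed.

Lemma cintegrableB f g : cintegrable f -> cintegrable g ->
  cintegrable (fun z => f z - g z).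
Proof.
move=> [f1 f2] [g1 g2]; split.
- have := integrableB measurableT f1 g1; apply: eq_integrable => // p _ /=.
  by case: (f _) => a b; case: (g _).
- have := integrableB measurableT f2 g2; apply: eq_integrable => // p _ /=.
  by case: (f _) => a b; case: (g _).
Qed.

Lemma cintegrableZ c f : cintegrable f -> cintegrable (fun z => c * f z).
Proof.
case: c => a b [f1 f2]; split.
- have := integrableB measurableT (integrableZl measurableT a f1) (integrableZl measurableT b f2).
  by apply: eq_integrable => // p _ /=; case: (f _).
- have := integrableD measurableT (integrableZl measurableT a f2) (integrableZl measurableT b f1).
  by apply: eq_integrable => // p _ /=; case: (f _).
Qed.

Lemma cintegralB f g : cintegrable f -> cintegrable g ->
  cintegral (fun z => f z - g z) = cintegral f - cintegral g.
Proof.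
move=> [f1 f2] [g1 g2]; rewrite /cintegral.
rewrite (_ : _ - _ = Complex (Rintegral (@dA R) setT (fun p => complex.Re (f (toC p))) -
   Rintegral (@dA R) setT (fun p => complex.Re (g (toC p))))
   (Rintegral (@dA R) setT (fun p => complex.Im (f (toC p))) -
   Rintegral (@dA R) setT (fun p => complex.Im (g (toC p)))))//.
rewrite -!RintegralB//; congr Complex; apply: eq_Rintegral => p _;
  by case: (f _) => a b; case: (g _).
Qed.

Lemma cintegralZ (c : R[i]) f : cintegrable f ->
  cintegral (fun z => c * f z) = c * cintegral f.
Proof.
case: c => a b [f1 f2]; rewrite /cintegral.
pose I := Rintegral (@dA R) setT (fun p => complex.Re (f (toC p))).
pose J := Rintegral (@dA R) setT (fun p => complex.Im (f (toC p))).
rewrite (_ : _ * _ = Complex (a * I - b * J) (a * J + b * I))//.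
rewrite /I /J -!RintegralZl//.
rewrite -RintegralB//; [|exact: (integrableZl measurableT a f1)
  |exact: (integrableZl measurableT b f2)].
rewrite -RintegralD//; [|exact: (integrableZl measurableT a f2)
  |exact: (integrableZl measurableT b f1)].
by congr Complex; apply: eq_Rintegral => p _; case: (f _).
Qed.

(** The real and imaginary parts of the integral are each at most the integral of [H], whence the
    factor 2. *)
Lemma cabs_cintegral_le g (H : R * R -> R) : cintegrable g ->
  (@dA R).-integrable setT (EFin \o H) ->
  (forall p, cabs (g (toC p)) <= H p) ->
  cabs (cintegral g) <= 2 * Rintegral (@dA R) setT H.
Proof.
move=> [g1 g2] iH gH; apply: le_trans (cabs_le_ReIm _ _) _ => /=.
rewrite mulrDl mul1r lerD//; (apply: le_trans; first exact: le_normr_Rintegral);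
  (apply: le_Rintegral => //; first exact: integrable_norm) => p _.
- exact: le_trans (normRe_le_cabs _ _) (gH p).
- exact: le_trans (normIm_le_cabs _ _) (gH p).
Qed.

End PlaneMeasurability.

(** * Toeplitz integrands, reproducing kernels and their Gaussian form *)

Section Toeplitz.
Local Open Scope complex_scope.
Variables (R : realType) (alpha : R) (phi : R[i] -> R).
Hypothesis alpha0 : 0 < alpha.
Hypothesis mphi : measurable_fun [set: R * R] (fun p : R * R => phi (toC p)).
Hypothesis phi0 : forall w, 0 <= phi w.

Let psi (p : R * R) := phi (toC p).
Let psi0 p : 0 <= psi p. Proof. exact: phi0. Qed.

(** Dictionary between the two scales: t = 2, 1, 1/2 correspond to the parameters alpha, alpha/2,
    alpha/4 used below. *)
Lemma tilde_phiE t (p : R * R) :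
  tilde_phi alpha phi t (toC p) = ((alpha / pi)%:E * heat R psi (alpha * t / 2) p)%E.
Proof.
rewrite /tilde_phi /heat; congr (_ * _)%E; apply: eq_integral => q _.
by rewrite /psi /hker /cnorm2/=; congr (_ * expR _)%:E; field.
Qed.

Lemma heat_integrable a k z : (heat R psi a z < +oo)%E ->
  (@dA R).-integrable setT (EFin \o (fun p => k * (psi p * hker R a z p))).
Proof.
move=> fin.
have ih : (@dA R).-integrable setT (fun p => (psi p * hker R a z p)%:E).
  apply/integrableP; split; first exact: measurable_psi_hker.
  under eq_integral do rewrite gee0_abs ?lee_fin ?mulr_ge0 ?hker_ge0//.
  exact: fin.
exact: (integrableZl measurableT k ih).
Qed.

Lemma Rintegral_heat a k z : (heat R psi a z < +oo)%E ->
  Rintegral (@dA R) setT (fun p => k * (psi p * hker R a z p)) = k * fine (heat R psi a z).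
Proof.
move=> fin; rewrite RintegralZl//.
have := heat_integrable a 1 z fin; apply: eq_integrable => // p _ /=.
by rewrite mul1r.
Qed.

Lemma KernE (p q : R * R) : Kern alpha (toC p) (toC q) =
  cexp (Complex (alpha * (p.1 * q.1 + p.2 * q.2)) (alpha * (p.1 * q.2 - p.2 * q.1))).
Proof. by rewrite /Kern/=; congr cexp; simpc; congr Complex; ring. Qed.

(** Completing the square, since |K_z(w)|^2 is the exponential of 2 alpha Re(conj(z) w). This links
    both condition (I_1) and T_phi K_z (z) to [heat] with parameter alpha. *)
Lemma Kern_gauss (p q : R * R) :
  cnorm2 (Kern alpha (toC p) (toC q)) * gauss alpha (toC q) =
  alpha / pi * expR (alpha * cnorm2 (toC p)) * hker R alpha p q.
Proof.
rewrite KernE -cabs2 cabs_cexp/= /gauss /hker /cnorm2/= expr2 -expRD.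
rewrite mulrCA -expRD -mulrA -expRD; congr (_ * expR _); ring.
Qed.

Lemma Re_Toep_integrand_Kern z w :
  complex.Re (Toep_integrand alpha phi (Kern alpha z) z w) =
  phi w * (cnorm2 (Kern alpha z w) * gauss alpha w).
Proof.
by rewrite /Toep_integrand /cnorm2; case: (Kern _ _ _) => a b /=; ring.
Qed.

(** For |h| <= 1 the factor e^{|hv|} is at most e^{|v|}, so |h|^2 splits off from a bound depending
    on [v] alone. *)
Lemma cexp_mul_error (h v : R[i]) : cabs h <= 1 ->
  cabs (cexp (h * v) - 1 - h * v) <=
  4 * cabs v ^+ 2 * expR (cabs v) * cabs h ^+ 2.
Proof.
move=> h1; apply: le_trans (cexp_taylor1_le _ _) _; rewrite cabsM exprMn.
rewrite (_ : 4 * cabs v ^+ 2 * _ * _ =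
  4 * (cabs h ^+ 2 * cabs v ^+ 2) * expR (cabs v)); last by ring.
by rewrite ler_wpM2l ?mulr_ge0 ?cabs_ge0// ler_expR ler_piMl ?cabs_ge0//.
Qed.

Lemma entire_Kern z : entire (Kern alpha z).
Proof.
move=> w; pose v := alpha%:C * z^*.
apply: (derivable_of_quadratic_error _ _ _ (Kern alpha z w * v)
  (cabs (Kern alpha z w) * (4 * cabs v ^+ 2 * expR (cabs v)))) => h h1.
have -> : Kern alpha z (w + h) = Kern alpha z w * cexp (h * v).
  by rewrite /Kern -cexpD /v; congr cexp; ring.
rewrite (_ : _ - _ - _ = Kern alpha z w * (cexp (h * v) - 1 - h * v)); last by ring.
by rewrite cabsM -mulrA ler_wpM2l ?cabs_ge0// cexp_mul_error.
Qed.

(** The exponents on the two sides differ by alpha |z - w|^2 / 2 >= 0. *)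
Lemma Finf_bound_Kern z : Finf_bound alpha (Kern alpha z) (expR (alpha * cnorm2 z / 2)).
Proof.
case: z => a b [c d]; rewrite (KernE (a, b) (c, d)) cabs_cexp -expRD ler_expR /cnorm2/=.
rewrite -subr_ge0 (_ : _ - _ = alpha / 2 * ((a - c) ^+ 2 + (b - d) ^+ 2)); last by field.
by rewrite mulr_ge0 ?addr_ge0 ?sqr_ge0// divr_ge0// ltW.
Qed.

(** * Necessity: testing on reproducing kernels *)

Lemma in_Linf_tilde_phi : cond_I1 alpha phi -> Toep_bounded_Finf alpha phi ->
  forall t, 0 < t -> in_Linf (tilde_phi alpha phi t).
Proof.
move=> I1 [C HC] t t0.
have api : 0 < alpha / pi by rewrite divr_gt0// pi_gt0.
have heat2 z : (heat R psi alpha z <= (C / (alpha / pi))%:E)%E.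
  pose k := alpha / pi * expR (alpha * cnorm2 (toC z)).
  have k0 : 0 < k by rewrite mulr_gt0 ?expR_gt0.
  (* The integral in (I_1) is [k] times this one. Finiteness rules out the default value 0 that
     [fine] gives to an infinite integral. *)
  have fin : (heat R psi alpha z < +oo)%E.
    have := I1 (toC z).
    rewrite (_ : (\int[_]_p _)%E = (k%:E * heat R psi alpha z)%E).
      have := heat_ge0 R psi psi0 alpha z.
      by case: (heat _ _ _ _) => [r| |] //; rewrite ?ltry// gt0_muley.
    rewrite /heat -ge0_integralZl//.
    - apply: eq_integral => q _; rewrite ger0_norm// -mulrA Kern_gauss -EFinM.
      by congr EFin; rewrite /k /psi; ring.
    - exact: measurable_psi_hker.
    - by move=> q _; rewrite lee_fin mulr_ge0 ?hker_ge0.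
    - by rewrite lee_fin ltW.
  have [_ [_ /(_ _ (Finf_bound_Kern (toC z)) (toC z))]] := HC _
    (conj (entire_Kern (toC z)) (ex_intro _ _ (Finf_bound_Kern (toC z)))).
  have -> : - (alpha * cnorm2 (toC z)) / 2 = - (alpha * cnorm2 (toC z) / 2) by ring.
  (* The norm of K_z and the weight at z each contribute e^{alpha |z|^2 / 2}; together they match
     the exponential in [k], which cancels below. *)
  rewrite expRN ler_pdivrMr ?expR_gt0// -(mulrA C) -expRD -splitr => TC.
  have : k * fine (heat R psi alpha z) <= C * expR (alpha * cnorm2 (toC z)).
    apply: le_trans TC; apply: le_trans (normRe_le_cabs _ _).
    apply: le_trans (ler_norm _); rewrite -Rintegral_heat//.
    rewrite le_eqVlt; apply/orP; left; apply/eqP; apply: eq_Rintegral => q _.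
    by rewrite Re_Toep_integrand_Kern Kern_gauss /k /psi; ring.
  rewrite /k mulrAC ler_pM2r ?expR_gt0// => hC.
  rewrite -[heat _ _ _ _]fineK ?ge0_fin_numE ?heat_ge0//.
  by rewrite lee_fin ler_pdivlMr// mulrC.
have [D HD] : exists D : R, forall z, (heat R psi (alpha * t / 2) z <= D%:E)%E.
  have c0 : 0 < alpha * t / 2 by rewrite divr_gt0// mulr_gt0.
  (* The case t < 2 uses the semigroup; the case t >= 2 uses monotonicity. *)
  have [ca|ca] := ltP (alpha * t / 2) alpha.
    apply: (heat_bound R psi mphi psi0 alpha _ (C / (alpha / pi))) => //.
    exact: aeW.
  exists (C / (alpha / pi)) => z; apply: le_trans (heat2 z).
  by apply: heat_anti => //; exact: ltW.
split.
- rewrite (_ : (fun p => _) = fun p => ((alpha / pi)%:E * heat R psi (alpha * t / 2) p)%E).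
    by apply: emeasurable_funM => //; exact: measurable_heat.
  by apply/funext => p; rewrite tilde_phiE.
- exists (alpha / pi * D); apply: aeW => p.
  rewrite tilde_phiE gee0_abs ?mule_ge0 ?heat_ge0 ?lee_fin ?(ltW api)//.
  by rewrite (EFinM (alpha / pi)) lee_wpmul2l// lee_fin ltW.
Qed.

(** * Sufficiency: pointwise domination and differentiation under the integral *)

Lemma heat_bounded_of_in_Linf a :
  (forall t, 0 < t -> in_Linf (tilde_phi alpha phi t)) -> 0 < a ->
  exists C : R, forall z, (heat R psi a z <= C%:E)%E.
Proof.
(* This t corresponds to the parameter 2a. Starting strictly above [a] lets [heat_bound] turn an
   almost-everywhere bound into one at every point. *)
move=> H a0; have t0 : 0 < 4 * a / alpha by rewrite divr_gt0// mulr_gt0.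
have api : 0 < alpha / pi by rewrite divr_gt0// pi_gt0.
have [_ [M HM]] := H _ t0.
apply: (heat_bound R psi mphi psi0 (2 * a) a (M / (alpha / pi))) => //; first by lra.
apply: filterS HM; first exact: (ae_filter_ringOfSetsType (@dA R)).
move=> p; rewrite tilde_phiE gee0_abs ?mule_ge0 ?heat_ge0 ?lee_fin ?(ltW api)//.
have -> : alpha * (4 * a / alpha) / 2 = 2 * a by field; rewrite gt_eqF.
have := heat_ge0 R psi psi0 (2 * a) p.
case: (heat _ _ _ _) => [r| |]//.
- by move=> _; rewrite -EFinM !lee_fin ler_pdivlMr// mulrC.
- by rewrite gt0_muley ?lte_fin.
Qed.


Lemma cmeas_Toep_integrand f z : entire f -> cmeas R (Toep_integrand alpha phi f z).
Proof.
move=> ef; apply: cmeasM; first apply: cmeasM.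
- apply: cmeas_real; apply: measurable_funM => //.
  rewrite /gauss /cnorm2/=; apply: measurable_funM => //.
  apply: measurableT_comp => //; apply: measurableT_comp => //.
  by apply: measurable_funM => //; apply: measurable_funD; apply: measurable_funX.
- exact: cmeas_entire.
- by apply: cmeas_conj; apply: cmeas_entire; exact: entire_Kern.
Qed.

(** Half of the Gaussian weight absorbs the growth of [f]; the other half is kept against the
    kernel. *)
Lemma cabs_Toep_integrand_le f M (z q : R * R) : Finf_bound alpha f M ->
  cabs (Toep_integrand alpha phi f (toC z) (toC q)) <=
  M * (alpha / pi) * psi q * expR (alpha * (z.1 * q.1 + z.2 * q.2) - alpha * cnorm2 (toC q) / 2).
Proof.
move=> /(_ (toC q)) fM; rewrite /Toep_integrand !cabsM cabs_real cabsJ KernE cabs_cexp/=.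
have g0 : 0 <= alpha / pi by rewrite divr_ge0 ?pi_ge0// ltW.
have gp : 0 <= phi (toC q) * gauss alpha (toC q).
  by apply: mulr_ge0 => //; apply: mulr_ge0 => //; exact: expR_ge0.
rewrite ger0_norm// /gauss.
set N := cnorm2 _ in fM *; set L := alpha * (_ + _).
rewrite (_ : expR (- (alpha * N)) = expR (- (alpha * N) / 2) * expR (- (alpha * N) / 2));
  last first.
  by rewrite -expRD; congr expR; field.
rewrite (_ : L - _ = L + - (alpha * N) / 2) ?expRD; last by field.
rewrite [leLHS](_ : _ = cabs (f (toC q)) * expR (- (alpha * N) / 2) *
  (alpha / pi * psi q * (expR L * expR (- (alpha * N) / 2)))); last by rewrite /psi; ring.
rewrite [leRHS](_ : _ = M * (alpha / pi * psi q * (expR L * expR (- (alpha * N) / 2))));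
  last by ring.
by apply: ler_wpM2r => //; do 2 apply: mulr_ge0 => //; exact: expR_ge0.
Qed.

(** Completing the square around [z] produces the integrand of tilde phi_1, which controls both
    absolute convergence and the norm. *)
Lemma cabs_Toep_integrand_heat f M (z q : R * R) : Finf_bound alpha f M ->
  cabs (Toep_integrand alpha phi f (toC z) (toC q)) <=
  M * (alpha / pi) * expR (alpha * cnorm2 (toC z) / 2) * (psi q * hker R (alpha / 2) z q).
Proof.
move=> fM; apply: le_trans (cabs_Toep_integrand_le f M z q fM) _.
rewrite le_eqVlt; apply/orP; left; apply/eqP.
rewrite [RHS](_ : _ = M * (alpha / pi) * psi q *
  (expR (alpha * cnorm2 (toC z) / 2) * hker R (alpha / 2) z q)); last by ring.
by congr (_ * _); rewrite /hker -expRD; congr expR; rewrite /cnorm2/=; field.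
Qed.

Lemma Finf_bound_ge0 f M : Finf_bound alpha f M -> 0 <= M.
Proof.
by move=> /(_ 0); apply: le_trans; rewrite mulr_ge0 ?cabs_ge0 ?expR_ge0.
Qed.

(** The spare factor e^{2 alpha |q|} is there to absorb the Taylor remainder of the kernel. It is
    paid for by weakening the Gaussian from alpha/2 to alpha/4, centred at the origin. *)
Lemma cabs_Toep_integrand_exp f M (z q : R * R) : Finf_bound alpha f M ->
  cabs (Toep_integrand alpha phi f (toC z) (toC q)) * expR (2 * (alpha * cabs (toC q))) <=
  M * (alpha / pi) * expR (alpha * (cabs (toC z) + 2) ^+ 2) *
  (psi q * hker R (alpha / 4) (0, 0) q).
Proof.
move=> fM; have M0 := Finf_bound_ge0 f M fM.
have g0 : 0 <= alpha / pi by rewrite divr_ge0 ?pi_ge0// ltW.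
apply: le_trans (ler_wpM2r (expR_ge0 _) (cabs_Toep_integrand_le f M z q fM)) _.
rewrite -(mulrA (M * (alpha / pi) * psi q)) -expRD.
rewrite [leRHS](_ : _ = M * (alpha / pi) * psi q *
  (expR (alpha * (cabs (toC z) + 2) ^+ 2) * hker R (alpha / 4) (0, 0) q)); last by ring.
have c0 : 0 <= M * (alpha / pi) * psi q by do 2 apply: mulr_ge0 => //.
rewrite ler_wpM2l// /hker -expRD ler_expR/=.
set r := cabs (toC q); set s := cabs (toC z).
have r2 : (0 - q.1) ^+ 2 + (0 - q.2) ^+ 2 = r ^+ 2.
  by rewrite cabs2 /cnorm2/=; ring.
have -> : cnorm2 (toC q) = r ^+ 2 by rewrite cabs2.
have zq : z.1 * q.1 + z.2 * q.2 <= s * r.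
  apply: le_trans (_ : complex.Re (toC z * (toC q)^*) <= _).
    by rewrite /= mulrN opprK.
  rewrite /s /r -(cabsJ _ (toC q)) -cabsM.
  by apply: le_trans (normRe_le_cabs _ _); exact: ler_norm.
rewrite r2.
(* This square is exactly the gap in alpha (s + 2) r - alpha r^2 / 2 <= alpha (s + 2)^2 - alpha r^2
   / 4. *)
have h : 0 <= alpha * (r / 2 - (s + 2)) ^+ 2 by rewrite mulr_ge0 ?sqr_ge0// ltW.
have h2 := ler_wpM2l (ltW alpha0) zq.
lra.
Qed.

Lemma Toep_bounded_of_in_Linf :
  (forall t, 0 < t -> in_Linf (tilde_phi alpha phi t)) -> Toep_bounded_Finf alpha phi.
Proof.
move=> H.
have g0 : 0 <= alpha / pi by rewrite divr_ge0 ?pi_ge0// ltW.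
have [C HC] := heat_bounded_of_in_Linf (alpha / 2) H (divr_gt0 alpha0 (ltr0n R 2)).
have [D HD] := heat_bounded_of_in_Linf (alpha / 4) H (divr_gt0 alpha0 (ltr0n R 4)).
have fin2 z : (heat R psi (alpha / 2) z < +oo)%E by rewrite (le_lt_trans (HC z)) ?ltry.
have fin4 z : (heat R psi (alpha / 4) z < +oo)%E by rewrite (le_lt_trans (HD z)) ?ltry.
exists (2 * (alpha / pi) * C) => f [ef [M0 fM0]].
have int_dom M z : Finf_bound alpha f M -> cintegrable R (Toep_integrand alpha phi f (toC z)).
  move=> fM; apply: cintegrable_dom (cabs_Toep_integrand_heat f M z ^~ fM).
    exact: cmeas_Toep_integrand.
  exact: heat_integrable.
split; [|split].
- case=> x y; have mI := cmeas_Toep_integrand f (toC (x, y)) ef.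
  apply: le_integrable (heat_integrable (alpha / 2)
    (M0 * (alpha / pi) * expR (alpha * cnorm2 (toC (x, y)) / 2)) (x, y) (fin2 _)) => //.
    by apply/measurable_EFinP; apply: measurable_cabs.
  move=> p _ /=; rewrite lee_fin ger0_norm ?cabs_ge0//.
  exact: le_trans (cabs_Toep_integrand_heat f M0 (x, y) p fM0) (ler_norm _).
- case=> x y; pose z := (x, y).
  (* The conjugate of K_z(w) is the exponential of z v(w), holomorphic in z: moving z by h
     multiplies it by e^{h v(w)}, and the derivative of T_phi f should be the integral of I v. *)
  pose v (w : R[i]) := alpha%:C * w^*.
  pose I := Toep_integrand alpha phi f (toC z).
  (* The 16: from 1 + r/2 <= e^{r/2} one gets r^2 <= 4 e^r, so the remainder factor 4 r^2 e^r is at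
     most 16 e^{2r}, with r = |v|. *)
  pose k := 16 * (M0 * (alpha / pi) * expR (alpha * (cabs (toC z) + 2) ^+ 2)).
  pose G q := k * (psi q * hker R (alpha / 4) (0, 0) q).
  have iG : (@dA R).-integrable setT (EFin \o G) by exact: heat_integrable.
  have mI : cmeas R I by exact: cmeas_Toep_integrand.
  have mv : cmeas R v.
    apply: cmeasM; first by apply: cmeas_real; exact: measurable_cst.
    by apply: cmeas_conj; split; [exact: measurable_fst|exact: measurable_snd].
  have cabs_v w : cabs (v w) = alpha * cabs w.
    by rewrite /v cabsM cabs_real gtr0_norm// cabsJ.
  have IG q : cabs (I (toC q)) * (16 * expR (2 * cabs (v (toC q)))) <= G q.
    rewrite mulrCA /G /k -(mulrA 16) ler_wpM2l// cabs_v.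
    exact: cabs_Toep_integrand_exp.
  have iIv : cintegrable R (fun w => I w * v w).
    apply: (cintegrable_dom R _ G) => //; first exact: cmeasM.
    move=> q; apply: le_trans (IG q); rewrite cabsM ler_wpM2l ?cabs_ge0//.
    have := expR_ge1Dx (2 * cabs (v (toC q))); have := cabs_ge0 R (v (toC q)); lra.
  apply: (derivable_of_quadratic_error _ _ _ (cintegral (fun w => I w * v w))
    (2 * Rintegral (@dA R) setT G)) => h h1.
  have Ih w : Toep_integrand alpha phi f (toC z + h) w = I w * cexp (h * v w).
    rewrite /I /Toep_integrand -(mulrA (_ * f w)); congr (_ * _).
    have conjE (x0 : R[i]) : Num.conj x0 = conjc x0 by [].
    rewrite /Kern !conjE !cexpJ -cexpD /v; congr cexp.
    case: (toC z) (w) (h) => [a b] [c d] [e1 e2] /=; simpc; congr Complex; ring.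
  have iIh : cintegrable R (Toep_integrand alpha phi f (toC z + h)).
    have -> : toC z + h = toC (x + complex.Re h, y + complex.Im h) by case: (h).
    exact: int_dom fM0.
  have iI : cintegrable R I by exact: int_dom fM0.
  rewrite /Toep -cintegralB// -cintegralZ// -cintegralB//; last 2 first.
  - exact: cintegrableB.
  - exact: cintegrableZ.
  rewrite -mulrA [_ * cabs h ^+ 2]mulrC -RintegralZl//.
  apply: cabs_cintegral_le.
  - by apply: cintegrableB; [exact: cintegrableB|exact: cintegrableZ].
  - exact: (integrableZl measurableT (cabs h ^+ 2) iG).
  move=> q; rewrite Ih -[Toep_integrand _ _ _ _ _]/(I (toC q)).
  rewrite [X in cabs X](_ : _ = I (toC q) * (cexp (h * v (toC q)) - 1 - h * v (toC q)));
    last by ring.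
  rewrite cabsM.
  apply: (@le_trans _ _ (cabs (I (toC q)) *
    (4 * cabs (v (toC q)) ^+ 2 * expR (cabs (v (toC q))) * cabs h ^+ 2))).
    by rewrite ler_wpM2l ?cabs_ge0// cexp_mul_error.
  rewrite mulrA [leRHS]mulrC ler_wpM2r ?sqr_ge0//; apply: le_trans (IG q).
  rewrite ler_wpM2l ?cabs_ge0//; set r := cabs (v _).
  rewrite (_ : 2 * r = r + r) ?expRD ?mulrA ?ler_wpM2r ?expR_ge0//; last by ring.
  have := expR_ge1Dx (r / 2); have := cabs_ge0 R (v (toC q)); rewrite -/r => r0 hr.
  have -> : expR r = expR (r / 2) * expR (r / 2) by rewrite -expRD -splitr.
  nra.
- move=> M fM; case=> x y; pose z := (x, y).
  set E := expR (alpha * cnorm2 (toC z) / 2).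
  have -> : expR (- (alpha * cnorm2 (toC z)) / 2) = E^-1.
    by rewrite /E -expRN; congr expR; ring.
  have E0 : 0 < E by exact: expR_gt0.
  (* The factor [E] of the dominating function is the inverse of the weight at z, so the resulting
     bound is uniform in z. *)
  rewrite ler_pdivrMr//.
  apply: le_trans (cabs_cintegral_le R _ _ (int_dom M z fM) (heat_integrable _ _ _ (fin2 z))
    (cabs_Toep_integrand_heat f M z ^~ fM)) _.
  rewrite Rintegral_heat//.
  have M1 := Finf_bound_ge0 f M fM.
  have hC : fine (heat R psi (alpha / 2) z) <= C.
    by rewrite -lee_fin fineK ?ge0_fin_numE ?heat_ge0.
  rewrite [leRHS](_ : _ = 2 * (M * (alpha / pi) * E * C)); last by ring.
  apply: ler_wpM2l => //; apply: ler_wpM2l => //.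
  by apply: mulr_ge0 (ltW E0); exact: mulr_ge0.
Qed.

End Toeplitz.

Theorem theorem4p3 (R : realType) (alpha : R) (phi : R[i] -> R) :
  0 < alpha ->
  measurable_fun [set: R * R] (fun p : R * R => phi (toC p)) ->
  (forall w : R[i], 0 <= phi w) ->
  cond_I1 alpha phi ->
  (Toep_bounded_Finf alpha phi <->
   forall t : R, 0 < t -> in_Linf (tilde_phi alpha phi t)).
Proof.
move=> alpha0 mphi phi0 I1; split.
- exact: in_Linf_tilde_phi.
- exact: Toep_bounded_of_in_Linf.
Qed.
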